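(* Let $X_n$, $n\in\omega$, be compact Hausdorff spaces. Then the box product $\square_n X_n$ is a $D$-space if and only if the nabla product $\nabla_n X_n$ is a $D$-space.
   Context: A neighbornet on a space $(X,\tau)$ is a map $U:X\to\tau$ with $x\in U(x)$ for all $x\in X$; for $S\subseteq X$ put $U(S)=\bigcup_{x\in S}U(x)$. $X$ is a $D$-space if for every neighbornet $U$ on $X$ there is a closed discrete $D\subseteq X$ with $U(D)=X$. The box product $\square_n X_n$ is the set $\prod_n X_n$ with the topology generated by all sets $\prod_n U_n$ with every $U_n$ open in $X_n$. The nabla product $\nabla_n X_n$ is the quotient space $(\square_n X_n)/{=^*}$, where $x=^*y$ iff $x(n)=y(n)$ for all but finitely many $n$. *)

(* Defs.v *)
From HB Require Import structures.
From mathcomp Require Import all_boot.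
From mathcomp Require Import all_classical topology.

Set Implicit Arguments.
Unset Strict Implicit.
Unset Printing Implicit Defensive.

Local Open Scope classical_set_scope.

Definition neighbornet (T : topologicalType) (U : T -> set T) : Prop :=
  forall x : T, open (U x) /\ U x x.

(* [D `<=` isolated D] says that the subspace topology of [D] is discrete. *)
Definition D_space (T : topologicalType) : Prop :=
  forall U : T -> set T, neighbornet U ->
    exists D : set T,
      [/\ closed D, D `<=` isolated D & \bigcup_(x in D) U x = [set: T]].

(* An alias, since [forall n, X n] itself is the carrier used by the library
   for the topology of pointwise convergence. *)
Definition box_product (X : nat -> topologicalType) : Type := forall n, X n.

Section box_product_topology.
Context (X : nat -> topologicalType).

Definition open_boxes : set (forall n, set (X n)) :=
  [set U | forall n, open (U n)].

Definition box (U : forall n, set (X n)) : set (box_product X) :=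
  [set x | forall n, U n (x n)].

Lemma open_boxes_cover : \bigcup_(U in open_boxes) box U = [set: box_product X].
Proof.
by rewrite -subTset => x _; exists (fun=> setT) => // n; exact: openT.
Qed.

Lemma open_boxes_join U V (x : box_product X) :
  open_boxes U -> open_boxes V -> box U x -> box V x ->
  exists W, [/\ open_boxes W, box W x & box W `<=` box U `&` box V].
Proof.
move=> oU oV Ux Vx; exists (fun n => U n `&` V n); split.
- by move=> n; exact: openI.
- by move=> n; split.
- by move=> y UVy; split=> n; case: (UVy n).
Qed.

HB.instance Definition _ := gen_eqMixin (box_product X).
HB.instance Definition _ := gen_choiceMixin (box_product X).
HB.instance Definition _ :=
  isBaseTopological.Build (box_product X) open_boxes_cover open_boxes_join.

End box_product_topology.

Section nabla_product.
Local Open Scope quotient_scope.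
Context (X : nat -> topologicalType).

Definition eq_almost (x y : box_product X) : bool :=
  `[< finite_set [set n | x n <> y n] >].

Lemma eq_almost_refl : reflexive eq_almost.
Proof.
move=> x; apply/asboolP; rewrite (_ : [set _ | _] = set0) //.
by rewrite -subset0 => n /=.
Qed.

Lemma eq_almost_sym : symmetric eq_almost.
Proof.
move=> x y; rewrite /eq_almost; congr (`[< finite_set _ >]).
by apply/seteqP; split=> n /= /nesym.
Qed.

Lemma eq_almost_trans : transitive eq_almost.
Proof.
move=> y x z /asboolP xy /asboolP yz; apply/asboolP.
apply: (sub_finite_set (B := [set n | x n <> y n] `|` [set n | y n <> z n])).
  move=> n /= xz; have [xyn|] := pselect (x n = y n); last by left.
  by right; rewrite -xyn.
by rewrite finite_setU.
Qed.

Canonical eq_almost_equiv :=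
  EquivRel eq_almost eq_almost_refl eq_almost_sym eq_almost_trans.

Definition nabla_product : Type :=
  quotient_topology {eq_quot eq_almost_equiv}.

HB.instance Definition _ := Topological.on nabla_product.
HB.instance Definition _ := Quotient.on nabla_product.

End nabla_product.

(* Main.v *)
Require Import Defs.
From mathcomp Require Import all_boot.
From mathcomp Require Import all_classical topology.

Local Open Scope classical_set_scope.

(** The quotient map from the box product onto the nabla product is continuous
and onto; compactness of the factors makes it closed, with sigma-compact
fibers. These properties and T1 transfer the D-property both ways.

Closed continuous surjections preserve D-spaces ([D_space_closed_image]): pull
the neighbornet back, and take the image of the closed discrete kernel found
upstairs. All subsets of a closed discrete set are closed, so all subsets of
its image are closed, which makes the image closed and discrete.

Conversely, let f : S -> T be a closed continuous map with sigma-compact fibers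
from a T1 space to a D-space ([D_space_closed_preimage]). For a neighbornet U on
S, each fiber is covered by U(D_t) for some D_t inside the fiber that is locally
finite at the points of the fiber ([sigma_compact_kernel]). As f is closed, t has
an open neighborhood V(t) whose preimage lies in U(D_t). A closed discrete E with
V(E) = T then yields the closed discrete kernel of U, the union of the D_t for t
in E.

The fiber through x is the union over n of the sets of points that agree with x
from n on. Such a set is a copy of the product of the first n factors; by the
tube argument ([tube_ideal]) it is compact ([compact_tail]), and an open set O
containing it contains all points whose coordinates from n on lie in some open
sets W_n(m) around x(m). If O contains the whole fiber, diagonalize: the sets
W_0(m), ..., W_m(m) have an open intersection D(m), and a point which is almost
everywhere in D belongs to O. The points almost everywhere in D form a saturated
set, so the map is closed ([nabla_pi_closed]). *)

(** * Closed discrete sets and closed images *)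

(** Being closed and discrete is a local condition on all points of the space,
and this is the form in which it is transported between spaces. *)
Lemma closed_discreteP {T : topologicalType} (D : set T) :
  closed D /\ D `<=` isolated D <->
  forall y, exists2 N, nbhs y N & N `&` D `<=` [set y].
Proof.
split=> [[cD iD] y|locD].
  have [Dy|nDy] := pselect (D y).
    by have [_ [N Ny ND]] := iD y Dy; exists N => //; rewrite ND.
  exists (~` D); first exact: open_nbhs_nbhs (conj (closed_openC cD) nDy).
  by rewrite setICl; exact: sub0set.
split=> [y Dy|y Dy].
  have [N Ny ND] := locD y; have [z [Dz Nz]] := Dy N Ny.
  by rewrite -(ND z).
split; first exact/mem_set.
have [N Ny ND] := locD y; exists N => //; apply/seteqP; split=> // _ ->.
by split=> //; exact: nbhs_singleton.
Qed.

Lemma closed_discrete_sub {T : topologicalType} (D D' : set T) :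
  closed D -> D `<=` isolated D -> D' `<=` D -> closed D'.
Proof.
move=> cD iD sD; have /closed_discreteP locD := conj cD iD.
suff [] : closed D' /\ D' `<=` isolated D' by [].
apply/closed_discreteP => y; have [N Ny ND] := locD y; exists N => //.
by apply: subset_trans ND; exact: setIS.
Qed.

Lemma neighbornet_open {T : topologicalType} (U : T -> set T) (D : set T) :
  neighbornet U -> open (\bigcup_(x in D) U x).
Proof. by move=> nU; apply: bigcup_open => x _; have [] := nU x. Qed.

Lemma D_space_closed_image {S T : topologicalType} (f : S -> T) :
  continuous f -> (forall t, exists s, f s = t) ->
  (forall C, closed C -> closed (f @` C)) -> D_space S -> D_space T.
Proof.
move=> cf sf clf DS V nV.
have [|D [cD iD UD]] := DS (fun x => f @^-1` V (f x)).
  move=> x; have [oV Vx] := nV (f x); split=> //.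
  exact: (proj1 (continuousP f)).
(* As f is closed, each subset of the image inherits closedness from D. *)
have clE E : E `<=` f @` D -> closed E.
  move=> sE; rewrite (_ : E = f @` (D `&` f @^-1` E)).
    by apply: clf; apply: (closed_discrete_sub _ _ cD iD); exact: subIsetl.
  apply/seteqP; split=> [t Et|_ [x [_ Ex] <-] //].
  by have [x Dx fx] := sE t Et; exists x => //; split=> //=; rewrite fx.
exists (f @` D).
suff [? ?] : closed (f @` D) /\ f @` D `<=` isolated (f @` D).
  split=> //; rewrite -subTset => t _; have [s <-] := sf t.
  have [x Dx Vs] : (\bigcup_(x in D) (f @^-1` V (f x))) s by rewrite UD.
  by exists (f x) => //; exists x.
apply/closed_discreteP => t; exists (~` (f @` D `\ t)); last first.
  by move=> z [nz Dz]; apply: contrapT => zt; exact: nz.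
apply: open_nbhs_nbhs; split; last by case=> _; apply.
by apply: closed_openC; apply: clE => z [].
Qed.

(** * Compactness through ideals *)

Definition set_ideal {T : Type} (P : set (set T)) :=
  [/\ P set0, forall A B, P A -> P B -> P (A `|` B)
    & forall A B, A `<=` B -> P B -> P A].

(** Induction over a compact set: if [P] omitted [K], the sets [B] with [K `\` B]
in [P] would form a proper filter containing [K] without cluster point in [K].
The finite subcovers are absorbed by the closure of [P] under unions. *)
Lemma compact_ideal {T : topologicalType} (K : set T) (P : set (set T)) :
  compact K -> set_ideal P -> (forall x, K x -> exists2 N, nbhs x N & P N) ->
  P K.
Proof.
move=> cK [P0 PU PS] locP; apply: contrapT => nPK.
pose F : set_system T := [set B | P (K `\` B)].
have PF : ProperFilter F.
  split; first by rewrite /F /= setD0.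
  split.
  - by rewrite /F /= setDT.
  - by move=> A B FA FB; rewrite /F /= setDIr; exact: PU.
  - by move=> A B AB; apply: PS; exact: setDS.
have FK : F K by rewrite /F /= setDv.
have [x [Kx clx]] := cK F PF FK; have [N Nx PN] := locP x Kx.
have FnN : F (~` N) by apply: PS PN => z [_]; exact: contrapT.
by have [z [nNz /nNz]] := clx (~` N) N FnN Nx.
Qed.

(** If a filter had no cluster point in [K], then the sets whose complement
belongs to it would be a local ideal on [K]. *)
Lemma compact_of_ideal {T : topologicalType} (K : set T) :
  (forall P : set (set T), set_ideal P ->
    (forall x, K x -> exists2 N, nbhs x N & P N) -> P K) -> compact K.
Proof.
move=> idK F PF FK; apply: contrapT => noclu.
have : F (~` K).
  apply: (idK (fun A => F (~` A))).
    split=> [|A B FA FB|A B AB].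
    - by rewrite setC0; exact: filterT.
    - by rewrite setCU; exact: filterI.
    - by apply: filterS; exact: subsetC.
  move=> x Kx; apply: contrapT => noN; apply: noclu; exists x; split=> // A B FA Bx.
  apply: contrapT => AB; apply: noN; exists B => //.
  by apply: filterS FA => z Az Bz; apply: AB; exists z.
move=> FnK; apply: (@filter_not_empty _ F).
by rewrite -(setICr K); exact: filterI.
Qed.

(** * Closed preimages with sigma-compact fibers *)

(** The points that [U] selects are chosen outside the open set already covered
by [E]; this is what later makes the union of all steps locally finite. Points of
[K] that are covered by [E] contribute no new center. *)
Lemma finite_net_step {T : topologicalType} (U : T -> set T) (K E : set T) :
  neighbornet U -> compact K ->
  exists D, [/\ finite_set D, D `<=` K `\` \bigcup_(x in E) U x
    & K `<=` \bigcup_(x in E `|` D) U x].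
Proof.
move=> nU cK; set UE := \bigcup_(x in E) U x.
pose P : set (set T) := [set A | exists D, [/\ finite_set D, D `<=` K `\` UE
    & A `<=` \bigcup_(x in E `|` D) U x]].
apply: (compact_ideal K P cK).
  split.
  - by exists set0; split=> //; exact: sub0set.
  - move=> A B [D [fD sD AD]] [D' [fD' sD' BD']]; exists (D `|` D'); split.
    + by rewrite finite_setU.
    + by rewrite subUset.
    + rewrite subUset; split.
        apply: subset_trans AD _; apply: bigcup_subset; apply: setUS.
        exact: subsetUl.
      apply: subset_trans BD' _; apply: bigcup_subset; apply: setUS.
      exact: subsetUr.
  - move=> A B AB [D [fD sD BD]]; exists D; split=> //.
    exact: subset_trans AB BD.
move=> x Kx; have [UEx|nUEx] := pselect (UE x).
  exists UE.
    exact: open_nbhs_nbhs (conj (neighbornet_open U E nU) UEx).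
  by exists set0; rewrite setU0; split=> //; exact: sub0set.
exists (U x); first exact: open_nbhs_nbhs (nU x).
exists [set x]; split=> [|_ ->|] //.
by apply: bigcup_sup; right.
Qed.

(** Iterating the previous step along [K] gives finite sets [E n]. The new points
of later stages avoid the open set covered by [E n], and every point of the union
lies in one of these open sets; so it has a neighborhood that meets the kernel in
a finite set, and T1 shrinks this to at most the point itself. Nothing is claimed
about points outside the union of the [K n]. *)
Lemma sigma_compact_kernel {T : topologicalType} (U : T -> set T)
    (K : nat -> set T) :
  accessible_space T -> neighbornet U -> (forall n, compact (K n)) ->
  exists D, [/\ D `<=` \bigcup_n K n, \bigcup_n K n `<=` \bigcup_(x in D) U x
    & forall y, (\bigcup_n K n) y ->
        exists2 N, nbhs y N & N `&` D `<=` [set y]].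
Proof.
move=> T1 nU cK.
have [g gP] := choice (fun p : nat * set T =>
  finite_net_step U (K p.1) p.2 nU (cK p.1)).
pose E := fix E n := if n is m.+1 then E m `|` g (m, E m) else set0.
have fE n : finite_set (E n).
  elim: n => [|n IH] //=; rewrite finite_setU; split=> //.
  by have [] := gP (n, E n).
have KE n : K n `<=` \bigcup_(x in E n.+1) U x.
  by have [] := gP (n, E n).
have sEK n : E n `<=` \bigcup_n K n.
  elim: n => [|n IH] /=; first exact: sub0set.
  rewrite subUset; split=> //.
  by have [_ sg _] := gP (n, E n); move=> x /sg [Kx _]; exists n.
have monoE n m : n <= m -> E n `<=` E m.
  elim: m => [|m IH]; first by rewrite leqn0 => /eqP ->.
  rewrite leq_eqVlt => /orP[/eqP -> //|/IH sE].
  by apply: subset_trans sE _; exact: subsetUl.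
have newE n m x : (\bigcup_(z in E n) U z) x -> E m x -> E n x.
  move=> UEx; elim: m => [|m IH] //= [/IH //|gx].
  have [_ sg _] := gP (m, E m); have [_ /= nUx] := sg x gx.
  have [nm|mn] := leqP n m; last by apply: (monoE _ _ mn); right.
  by exfalso; apply: nUx; move: UEx; apply: bigcup_subset; exact: monoE.
exists (\bigcup_n E n); split.
- by move=> x [n _ Ex]; exact: sEK Ex.
- by move=> x [n _ /KE [z Ez Ux]]; exists z => //; exists n.+1.
move=> y [n _ /KE UEy].
exists (\bigcup_(x in E n.+1) U x `&` ~` (E n.+1 `\ y)).
  apply: filterI; apply: open_nbhs_nbhs; split=> //.
  - exact: neighbornet_open.
  - apply: closed_openC; apply: (proj1 accessible_finite_set_closed T1).
    by apply: finite_setD.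
  - by case=> _; apply.
move=> z [[UEz nEz] [m _ Emz]]; apply: contrapT => zy; apply: nEz.
by split=> //; exact: newE Emz.
Qed.

Lemma D_space_closed_preimage {S T : topologicalType} (f : S -> T) :
  accessible_space S -> continuous f -> (forall C, closed C -> closed (f @` C)) ->
  (forall t, exists2 K : nat -> set S, forall n, compact (K n) &
    f @^-1` [set t] = \bigcup_n K n) ->
  D_space T -> D_space S.
Proof.
move=> T1 cf clf scf DT U nU.
have kerf t : exists D, [/\ D `<=` f @^-1` [set t],
    f @^-1` [set t] `<=` \bigcup_(x in D) U x
    & forall y, f y = t -> exists2 N, nbhs y N & N `&` D `<=` [set y]].
  have [K cK fK] := scf t.
  have [D [sD DU locD]] := sigma_compact_kernel U K T1 nU cK.
  exists D; rewrite fK; split=> // y fy; apply: locD.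
  by rewrite -fK.
have [D DP] := choice kerf.
(* Closedness of f makes V t open, with preimage inside U(D t). *)
pose V t := ~` (f @` ~` (\bigcup_(x in D t) U x)).
have [|E [cE iE VE]] := DT V.
  move=> t; split.
    by apply: closed_openC; apply: clf; apply: open_closedC; exact: neighbornet_open.
  by have [_ sD _] := DP t; move=> [x nUx ft]; apply: nUx; exact: sD.
have /closed_discreteP locE := conj cE iE.
exists (\bigcup_(t in E) D t).
suff [? ?] : closed (\bigcup_(t in E) D t) /\
    \bigcup_(t in E) D t `<=` isolated (\bigcup_(t in E) D t).
  split=> //; rewrite -subTset => x _.
  have [t Et Vt] : (\bigcup_(t in E) V t) (f x) by rewrite VE.
  have [z Dz Uz] : (\bigcup_(z in D t) U z) x.
    by apply: contrapT => nUx; apply: Vt; exists x.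
  by exists z => //; exists t.
(* Over a small neighborhood O of f y, only the part of the kernel in the fiber
   of y itself survives. *)
apply/closed_discreteP => y; have [O Oy OE] := locE (f y).
have [_ _ /(_ y erefl) [N Ny ND]] := DP (f y).
exists (f @^-1` O `&` N); first by apply: filterI => //; exact: cf.
move=> z [[Oz Nz] [t Et Dz]]; apply: ND; split=> //.
have [sD _ _] := DP t; move: (sD z Dz) => /= fz.
by rewrite -(OE t) //; split=> //; rewrite -fz.
Qed.

(** * Compactness in box products *)

Section box_product_theory.
Context {X : nat -> topologicalType}.

Lemma open_box (U : forall n, set (X n)) : (forall n, open (U n)) -> open (box U).
Proof.
move=> oU; exists [set U]; last by rewrite bigcup_set1.
by move=> _ ->.
Qed.

Lemma nbhs_box (x : box_product X) (N : set (box_product X)) :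
  nbhs x N -> exists U, [/\ forall n, open (U n), box U x & box U `<=` N].
Proof.
rewrite nbhsE => -[O [[D sD DO] Ox] ON].
move: Ox; rewrite -DO => -[U DU Ux]; exists U; split=> //; first exact: sD.
by move=> y Uy; apply: ON; rewrite -DO; exists U.
Qed.

Lemma accessible_box_product :
  (forall n, accessible_space (X n)) -> accessible_space (box_product X).
Proof.
move=> T1 x y /eqP xy.
have [n xyn] : exists n, x n <> y n.
  apply: contrapT => nxy; apply: xy; apply: functional_extensionality_dep => n.
  by apply: contrapT => xyn; apply: nxy; exists n.
(* Remove y m from the coordinates where x and y differ: the box contains x, and
   y fails it at n. *)
exists (box (fun m => [set a | a <> y m \/ x m = y m])); split.
- apply: open_box => m; have [xym|xym] := pselect (x m = y m).
    rewrite (_ : [set _ | _] = setT); first exact: openT.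
    by apply/seteqP; split=> // a _; right.
  rewrite (_ : [set _ | _] = ~` [set y m]).
    by apply: closed_openC; exact: accessible_closed_set1.
  by apply/seteqP; split=> a /=; [case|left].
- by apply/mem_set => m /=; have [|] := pselect (x m = y m); [right|left].
- by apply/mem_set => /(_ n) [].
Qed.

(** A box that is unrestricted below [n]; it keeps the type of the whole product,
so that no product of a segment of the factors is needed. *)
Definition tail_box (U : forall n, set (X n)) (n : nat) : set (box_product X) :=
  [set y | forall m, n <= m -> U m (y m)].

Lemma open_tail_box U n : (forall m, open (U m)) -> open (tail_box U n).
Proof.
move=> oU; apply: (open_box (fun m => [set a | n <= m -> U m a])) => m.
case: (n <= m).
  by rewrite (_ : [set _ | _] = U m) //; apply/seteqP; split=> a //= /(_ isT).
by rewrite (_ : [set _ | _] = setT); [exact: openT|apply/seteqP; split].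
Qed.

(** Tube lemma for the points that agree with [x] from [n] on. Taking for [P] the
subsets of an open set gives the usual tube lemma, and the ideal attached to a
filter gives compactness. Induction on [n]: the tubes around [x] modified at
coordinate [n] have cross-sections that cover the compact factor [X n], and
[compact_ideal] merges finitely many of them by intersecting the later
coordinates. *)
Lemma tube_ideal (P : set (set (box_product X))) :
  (forall n, compact [set: X n]) -> set_ideal P ->
  forall n (x : box_product X),
  (forall y, tail_box (fun m => [set x m]) n y -> exists2 N, nbhs y N & P N) ->
  exists U, [/\ forall m, open (U m), tail_box U n x & P (tail_box U n)].
Proof.
move=> cX [P0 PU PS]; elim=> [|n IH] x locP.
  have [|N Nx PN] := locP x; first by move=> m _.
  have [U [oU Ux UN]] := nbhs_box x N Nx; exists U; split=> //.
  by apply: PS PN => y Uy; apply: UN => m; exact: Uy.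
pose Q : set (set (X n)) := [set B | exists U, [/\ forall m, open (U m),
  tail_box U n.+1 x & P [set y | B (y n) /\ tail_box U n.+1 y]]].
suff [U [oU Ux PU']] : Q setT.
  by exists U; split=> //; apply: PS PU' => y Uy.
apply: (compact_ideal _ Q (cX n)).
  split.
  - exists (fun=> setT); split=> //; first by move=> m; exact: openT.
    by apply: PS P0 => y [].
  - move=> A B [U [oU Ux PA]] [W [oW Wx PB]].
    exists (fun m => U m `&` W m); split.
    + by move=> m; exact: openI.
    + by move=> m nm; split; [exact: Ux|exact: Wx].
    + apply: PS (PU _ _ PA PB) => y [ABy UWy].
      by case: ABy => [Ay|By]; [left|right]; split=> // m /UWy [].
  - move=> A B AB [U [oU Ux PB]]; exists U; split=> //.
    by apply: PS PB => y [/AB].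
(* The n-th coordinate is moved from the tail of the box to its free part. *)
move=> a _; pose x' : box_product X := dfwith x n a.
have x'E m : n < m -> x' m = x m.
  by move=> nm; rewrite /x' dfwithout // ltn_eqF.
have [|U [oU Ux' PU']] := IH x'.
  move=> y yx'; apply: locP => m nm /=.
  by rewrite -x'E //; apply: yx'; exact: ltnW.
exists (U n).
  apply: open_nbhs_nbhs; split=> //.
  by have := Ux' n (leqnn n); rewrite /x' dfwithin.
exists U; split=> //.
  by move=> m nm; rewrite -x'E //; apply: Ux'; exact: ltnW.
apply: PS PU' => y [Uyn Uy] m.
by rewrite leq_eqVlt => /orP[/eqP <- //|]; exact: Uy.
Qed.

Lemma compact_tail (x : box_product X) n :
  (forall n, compact [set: X n]) -> compact (tail_box (fun m => [set x m]) n).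
Proof.
move=> cX; apply: compact_of_ideal => P iP locP.
have [U [_ Ux PU]] := tube_ideal P cX iP n x locP.
have [_ _ PS] := iP; apply: PS PU => y yx m nm.
by rewrite yx //; exact: Ux.
Qed.

(** * The quotient map onto the nabla product *)

Local Open Scope quotient_scope.
Local Notation q := (\pi_(nabla_product X) : box_product X -> nabla_product X).

Lemma nabla_piP (x y : box_product X) :
  q x = q y <-> exists n, tail_box (fun m => [set y m]) n x.
Proof.
have -> : (q x = q y) = (eq_almost x y : Prop).
  by apply/propext; split=> /(eqmodP (eq_almost_equiv X)).
split=> [/asboolP fxy|[n xy]].
  have [n nP] : exists n, forall m, x m <> y m -> m < n.
    have [s sP] := (proj1 (finite_seqP _) fxy).
    exists (\max_(i <- s) i).+1 => m xym; rewrite ltnS.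
    apply: leq_bigmax_seq => //.
    by rewrite (_ : (m \in s : Prop) = [set` s] m) // -sP.
  exists n => m nm /=; apply: contrapT => /nP; by rewrite ltnNge nm.
apply/asboolP; apply: sub_finite_set (finite_II n) => m /= xym.
by rewrite ltnNge; apply/negP => nm; apply: xym; exact: xy.
Qed.

(** The complement of the saturation of [C] is open: around [x] it contains the
box of the diagonal sets [D m], because a point [z] almost equal to a point of that
box satisfies [W n] from some [n] on, hence avoids [C]. *)
Lemma nabla_pi_closed :
  (forall n, compact [set: X n]) -> forall C, closed C -> closed (q @` C).
Proof.
move=> cX C cC; rewrite -openC; change (open (q @^-1` (~` (q @` C)))).
rewrite openE => x /= nCx.
have nC y : q y = q x -> ~ C y by move=> yx Cy; apply: nCx; exists y.
have tube n : exists U, [/\ forall m, open (U m), tail_box U n x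
    & tail_box U n `<=` ~` C].
  apply: (tube_ideal [set A | A `<=` ~` C] cX).
    split; first exact: sub0set.
      by move=> A B AC BC; rewrite /= subUset.
    by move=> A B AB BC; exact: subset_trans AB BC.
  move=> y xy; exists (~` C) => //; apply: open_nbhs_nbhs.
  by split; [exact: closed_openC|apply: nC; apply/nabla_piP; exists n].
have [W WP] := choice tube.
(* Only the tubes of index at most m constrain coordinate m, so D m is open. *)
pose D m := \bigcap_(n in `I_m.+1) W n m.
have oD m : open (D m).
  rewrite -closedC /D setC_bigcap; apply: closed_bigcup; first exact: finite_II.
  by move=> n _; rewrite closedC; have [] := WP n.
have Dx n : tail_box D n x.
  by move=> m _ k km; have [_ Wx _] := WP k; exact: Wx.
suff sD : tail_box D 0 `<=` q @^-1` (~` (q @` C)).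
  apply: filterS sD _; apply: open_nbhs_nbhs; split; last exact: Dx.
  exact: open_tail_box.
move=> y Dy [z Cz /nabla_piP [n zy]].
have [_ _ /(_ z)] := WP n; apply=> // m nm.
by rewrite (zy m nm); apply: (Dy m).
Qed.

End box_product_theory.

Theorem theorem2 (X : nat -> topologicalType)
    (compact_X : forall n, compact [set: X n])
    (hausdorff_X : forall n, hausdorff_space (X n)) :
  D_space (box_product X) <-> D_space (nabla_product X).
Proof.
have closed_q := nabla_pi_closed compact_X.
split.
  apply: D_space_closed_image closed_q; first exact: pi_continuous.
  by move=> t; exists (repr t); exact: reprK.
apply: D_space_closed_preimage closed_q _.
- by apply: accessible_box_product => n; exact: hausdorff_accessible.
- exact: pi_continuous.
move=> t; exists (fun n => tail_box (fun m => [set (repr t : box_product X) m]) n).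
  by move=> n; exact: compact_tail.
apply/seteqP; split=> x /=.
  by rewrite -{1}(reprK t) => /nabla_piP [n xn]; exists n.
by case=> n _ xn; rewrite -[RHS]reprK; apply/nabla_piP; exists n.
Qed.
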